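(* Let $\mathcal N\colon \mathrm{ESpSe}\to\mathrm{LWB}$ be the nerve functor (defined in the context). Then $\mathcal N$ has a left adjoint $\mathcal Q\colon \mathrm{LWB}\to \mathrm{ESpSe}$ with the following description. To a linear witness book $L$ it assigns the extended spectral sequence $\mathcal Q(L)$ with $\mathcal Q(L)_0=L_0$ and, for $r>0$, $$\mathcal Q(L)_r=L_r/S_r(L),$$ with differential induced by that of $L_r$ and with characteristic map $\varphi_r\colon \mathcal Q(L)_r\to H(\mathcal Q(L)_{r-1})$ given by $\varphi_r(\overline a)=[\overline{w_r(a)}]$ (bars denote classes in the quotients by $S_r(L)$, resp. $S_{r-1}(L)$, and square brackets denote homology classes). For every extended spectral sequence $X$, the counit $\epsilon_X\colon \mathcal Q\mathcal N(X)\to X$ of the adjunction $\mathcal Q\dashv\mathcal N$ is induced by the projections $\mathcal N(X)_r\to X_r$, $(x_0,\dots,x_r;x_0',\dots,x'_r)\mapsto x_r$, and the counit is an isomorphism on every component. In particular $\mathcal N$ is fully faithful and $\mathcal Q$ is essentially surjective. For every linear witness book $L$, the unit $\eta_L\colon L\to\mathcal N\mathcal Q(L)$ is given, for $a\in L_r$, by $$(\eta_L)_r(a)=\left(\overline{w^r(a)},\ldots,\overline{w(a)},\overline{a};\ \overline{w^r(d_ra)},\ldots,\overline{w(d_ra)},\overline{d_ra}\right),$$ where $w^j\colon L_r\to L_{r-j}$ denotes the $j$-fold iterated witness map; and the unit is componentwise surjective.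
   Context: $R$ is a commutative ring with unit. A bigraded module is a family $A=\{A^{p,n}\}_{p,n\in\mathbb Z}$ of $R$-modules. For $r\ge 0$, an $r$-bigraded complex is a bigraded module with $R$-linear maps $d_r\colon A^{p,n}\to A^{p-r,n+1-r}$, $d_r^2=0$; morphisms are bidegree-preserving maps commuting with $d_r$; $H(A)=\ker d_r/\operatorname{im} d_r$ is a bigraded module. Extended spectral sequence $(X,\varphi)$: a family of $r$-bigraded complexes $(X_r,d_r)$, $r\ge0$, with morphisms of bigraded modules $\varphi_{r+1}\colon X_{r+1}\to H(X_r)$, $r\ge 0$ (characteristic maps). A morphism $f\colon X\to Y$ is a family of morphisms of $r$-bigraded complexes $f_r\colon X_r\to Y_r$ with $\varphi^Y_{r+1}f_{r+1}=H(f_r)\varphi^X_{r+1}$. The category is $\mathrm{ESpSe}$. Linear witness book $L$: a family of $r$-bigraded complexes $(L_r,d_r)$, $r\ge0$, with $R$-linear witness maps $w_{r+1}\colon L_{r+1}\to L_r$ of bidegree $(0,0)$ and degeneracy maps $s_r\colon L_r\to L_{r+1}$ of bidegree $(1,1)$ such that $w_{r+1}s_r=0$, $s_rw_{r+1}=0$, $d_r=w_{r+1}d_{r+1}s_r$ for all $r\ge0$. A morphism is a family of morphisms of $r$-bigraded complexes compatible with all $w$ and $s$. The category is $\mathrm{LWB}$. For $r>0$, $S_r(L)=s_{r-1}L_{r-1}+d_rs_{r-1}L_{r-1}\subseteq L_r$, a sub-$r$-bigraded complex; $S_0(L)=0$. Nerve functor $\mathcal N$: for $X\in\mathrm{ESpSe}$,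 $\mathcal N(X)_r^{p,n}$ is the module of pairs $(x;x')=((x_0,\dots,x_r);(x'_0,\dots,x'_r))$ with $x_i\in X_i^{p,n}$, $x'_i\in X_i^{p-r,n+1-r}$, such that for $0\le i<r$: $d_ix_i=0$, $\varphi_{i+1}(x_{i+1})=[x_i]$, $d_ix'_i=0$, $\varphi_{i+1}(x'_{i+1})=[x'_i]$, and moreover $d_rx_r=x'_r$. The structure maps are $d_r(x;x')=(x';0)$, $w_r(x;x')=((x_0,\dots,x_{r-1});0)$, $s_r(x;x')=(0;(x'_0,\dots,x'_r,0))$. On morphisms $\mathcal N$ acts entrywise. *)

(* Defs.v *)
From HB Require Import structures.
From mathcomp Require Import all_boot all_order all_algebra.
From mathcomp Require Import boolp.

Set Implicit Arguments.
Unset Strict Implicit.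
Unset Printing Implicit Defensive.

Import GRing.Theory.
Local Open Scope ring_scope.
Local Open Scope quotient_scope.
Local Obligation Tactic := intros.

Record category := Category {
  ob :> Type;
  mor : ob -> ob -> Type;
  idm : forall a, mor a a;
  compm : forall a b c, mor b c -> mor a b -> mor a c;
  comp_idl : forall a b (f : mor a b), compm (idm b) f = f;
  comp_idr : forall a b (f : mor a b), compm f (idm a) = f;
  compA : forall a b c e (h : mor c e) (g : mor b c) (f : mor a b),
    compm h (compm g f) = compm (compm h g) f }.

Arguments mor {_} _ _.
Arguments idm {_} _.
Arguments compm {_ _ _ _} _ _.

Definition is_iso (C : category) (a b : C) (f : mor a b) :=
  exists g : mor b a, compm g f = idm a /\ compm f g = idm b.

Definition isomorphic (C : category) (a b : C) := exists f : mor a b, is_iso f.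

Record functor (C D : category) := Functor {
  fob :> C -> D;
  fmap : forall a b, mor a b -> mor (fob a) (fob b);
  fmap_id : forall a, fmap (idm a) = idm (fob a);
  fmap_comp : forall a b c (g : mor b c) (f : mor a b),
    fmap (compm g f) = compm (fmap g) (fmap f) }.

Arguments fmap {_ _} _ {_ _} _.

Record adjunction (C D : category) (F : functor C D) (G : functor D C) :=
  Adjunction {
  adj_unit : forall a, mor a (G (F a));
  adj_counit : forall b, mor (F (G b)) b;
  unit_nat : forall a a' (f : mor a a'),
    compm (fmap G (fmap F f)) (adj_unit a) = compm (adj_unit a') f;
  counit_nat : forall b b' (f : mor b b'),
    compm (adj_counit b') (fmap F (fmap G f)) = compm f (adj_counit b);
  triangleF : forall a, compm (adj_counit (F a)) (fmap F (adj_unit a)) = idm (F a);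
  triangleG : forall b, compm (fmap G (adj_counit b)) (adj_unit (G b)) = idm (G b) }.

Definition fully_faithful (C D : category) (F : functor C D) :=
  forall a b, bijective (fun f : mor a b => fmap F f).

Definition essentially_surjective (C D : category) (F : functor C D) :=
  forall b : D, exists a : C, isomorphic (F a) b.

Definition mklin (R : pzRingType) (U V : lmodType R) (f : U -> V)
    (f_lin : linear f) : {linear U -> V} :=
  HB.pack f (GRing.isLinear.Build R U V *:%R f f_lin).

Lemma linear_ext (R : pzRingType) (U V : lmodType R) (f g : {linear U -> V}) :
  f =1 g -> f = g.
Proof.
case: f g => f [[f1] [f2]] [g [[g1] [g2]]] /= /funext fg.
by case: _ / fg g1 g2 => g1 g2; rewrite (Prop_irrelevance f1 g1)
  (Prop_irrelevance f2 g2).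
Qed.

Section QuotientModule.
Variables (R : pzRingType) (V : lmodType R) (I : submodClosed V).

Definition qpred : V -> bool := fun x => x \in I.

Fact qpred_closed : zmod_closed qpred.
Proof.
split=> [|x y xI yI]; first exact: (rpred0 I).
by rewrite -scaleN1r; apply: (rpredD (S := I)) => //; apply: (rpredZ (s := I)).
Qed.
Definition qclosed : zmodClosed V := HB.pack_for (zmodClosed V) qpred
  (GRing.isZmodClosed.Build V qpred qpred_closed).

Definition quotmod := Quotient.quot qclosed.
HB.instance Definition _ := GRing.Zmodule.on quotmod.
HB.instance Definition _ := ZmodQuotient.on quotmod.

Definition qclass (x : V) : quotmod := \pi_quotmod x.

Lemma qclass_eq x y : (qclass x = qclass y) <-> (x - y \in I).
Proof.
rewrite /qclass; split=> [/eqP|h].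
  by rewrite -(Quotient.idealrBE qclosed).
by apply/eqP; rewrite -(Quotient.idealrBE qclosed).
Qed.

Lemma qclass_ex (q : quotmod) : exists x, q = qclass x.
Proof. by exists (repr q); rewrite /qclass reprK. Qed.

Lemma qclass_repr x : repr (qclass x) - x \in I.
Proof. by rewrite -qclass_eq /qclass reprK. Qed.

Lemma qclassD x y : qclass (x + y) = qclass x + qclass y.
Proof. exact: (raddfD (\pi_quotmod)). Qed.

Definition qscale (a : R) (q : quotmod) : quotmod := qclass (a *: repr q).

Lemma qscaleE a x : qscale a (qclass x) = qclass (a *: x).
Proof. by apply/qclass_eq; rewrite -scalerBr; apply/rpredZ/qclass_repr. Qed.

Fact qscaleA a b q : qscale a (qscale b q) = qscale (a * b) q.
Proof. by have [x ->] := qclass_ex q; rewrite !qscaleE scalerA. Qed.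
Fact qscale1 : left_id 1 qscale.
Proof. by move=> q; have [x ->] := qclass_ex q; rewrite qscaleE scale1r. Qed.
Fact qscaleDr : right_distributive qscale +%R.
Proof.
move=> a p q; have [x ->] := qclass_ex p; have [y ->] := qclass_ex q.
by rewrite -qclassD !qscaleE -qclassD scalerDr.
Qed.
Fact qscaleDl q : {morph qscale^~ q : a b / a + b}.
Proof.
by move=> a b; have [x ->] := qclass_ex q; rewrite !qscaleE -qclassD scalerDl.
Qed.
HB.instance Definition _ := GRing.Zmodule_isLmodule.Build R quotmod
  qscaleA qscale1 qscaleDr qscaleDl.

Fact qclass_linear : linear qclass.
Proof. by move=> a x y; rewrite qclassD -qscaleE. Qed.
HB.instance Definition _ :=
  GRing.isLinear.Build R V quotmod *:%R qclass qclass_linear.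

End QuotientModule.

(* The map induced by [f] on quotients, meaningful when [f] maps [I] to [J]. *)
Definition qmap (R : pzRingType) (V W : lmodType R) (I : submodClosed V)
    (J : submodClosed W) (f : V -> W) (q : quotmod I) : quotmod J :=
  qclass J (f (repr q)).

Section InducedMap.
Variables (R : pzRingType) (V W : lmodType R).
Variables (I : submodClosed V) (J : submodClosed W) (f : {linear V -> W}).
Hypothesis fIJ : forall x, x \in I -> f x \in J.

Lemma qmapE x : qmap J f (qclass I x) = qclass J (f x).
Proof. by apply/qclass_eq; rewrite -linearB; apply/fIJ/qclass_repr. Qed.

Lemma qmap_linear : linear (qmap (I := I) J f).
Proof.
move=> a p q; have [x ->] := qclass_ex p; have [y ->] := qclass_ex q.
by rewrite -linearP !qmapE !linearP.
Qed.

End InducedMap.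

(* Degrees (p, n) are elements of the additive group [int * int]. *)
Definition bdeg (r : nat) : int * int := (- r%:Z, 1 - r%:Z).

(* To avoid transports along equations between degrees, a map of bidegree [b]
   is indexed by source degree [i], target degree [j] and a proof of
   [j = i + b]; such proofs are unique, so this is one map for each [i]. *)
Record cx (R : comPzRingType) (r : nat) := Cx {
  cx_mod :> int * int -> lmodType R;
  cx_d : forall i j, j = i + bdeg r -> {linear cx_mod i -> cx_mod j};
  cx_dd : forall i j k (e : j = i + bdeg r) (e' : k = j + bdeg r) x,
    cx_d e' (cx_d e x) = 0 }.

Record cxmor (R : comPzRingType) (r : nat) (A B : cx R r) := Cxmor {
  cxm :> forall i, {linear A i -> B i};
  cxm_d : forall i j (e : j = i + bdeg r) x,
    cxm j (cx_d A e x) = cx_d B e (cxm i x) }.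

Lemma cxmor_ext (R : comPzRingType) r (A B : cx R r) (f g : cxmor A B) :
  (forall i x, f i x = g i x) -> f = g.
Proof.
case: f g => f fd [g gd] /= fg.
have E : f = g by apply: functional_extensionality_dep => i; apply/linear_ext/fg.
by case: _ / E gd {fg} => gd; rewrite (Prop_irrelevance fd gd).
Qed.

Definition cxid (R : comPzRingType) r (A : cx R r) : cxmor A A :=
  @Cxmor _ _ A A (fun i => idfun) (fun i j e x => erefl).

Fact cxcomp_d (R : comPzRingType) r (A B C : cx R r) (g : cxmor B C)
    (f : cxmor A B) i j (e : j = i + bdeg r) x :
  g j (f j (cx_d A e x)) = cx_d C e (g i (f i x)).
Proof. by rewrite !cxm_d. Qed.

Definition cxcomp (R : comPzRingType) r (A B C : cx R r) (g : cxmor B C)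
    (f : cxmor A B) : cxmor A C :=
  @Cxmor _ _ A C (fun i => (g i \o f i : {linear _ -> _})) (cxcomp_d g f).

Section Homology.
Variables (R : comPzRingType) (r : nat) (A : cx R r) (i : int * int).

Definition kerd : pred (A i) := fun x => cx_d A (erefl (i + bdeg r)) x == 0.

Fact kerd_closed : submod_closed kerd.
Proof.
split=> [|a x y /eqP xZ /eqP yZ]; rewrite /kerd ?inE; apply/eqP.
  exact: linear0.
by rewrite linearP xZ yZ scaler0 addr0.
Qed.
HB.instance Definition _ := GRing.isSubmodClosed.Build R (A i) kerd kerd_closed.

Record cycle := Cycle { cyc : A i; cycP : kerd cyc }.
HB.instance Definition _ := [isSub for cyc].
HB.instance Definition _ := [Choice of cycle by <:].
HB.instance Definition _ := [SubChoice_isSubLmodule of cycle by <:].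

Definition boundary_pred : cycle -> bool :=
  fun z => `[< exists j (e : i = j + bdeg r) (y : A j), cyc z = cx_d A e y >].

Fact boundary_closed : submod_closed boundary_pred.
Proof.
split=> [|a x y /asboolP[j [e [u xE]]] /asboolP[j' [e' [v yE]]]]; apply/asboolP.
  by exists (i - bdeg r), (esym (subrK _ _)), 0; rewrite linear0.
have ej : j = j' by apply: (addIr (bdeg r)); rewrite -e.
subst j'; exists j, e, (a *: u + v).
by rewrite linearP -xE (eq_irrelevance e e') -yE.
Qed.
Definition boundary : submodClosed cycle :=
  HB.pack_for (submodClosed cycle) boundary_pred
    (GRing.isSubmodClosed.Build R cycle boundary_pred boundary_closed).

Definition homology : lmodType R := quotmod boundary.

(* [x] is a cycle and [h = [x]] *)
Definition is_class (x : A i) (h : homology) :=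
  exists xZ : kerd x, h = qclass boundary (Cycle xZ).

End Homology.

Section HomologyMap.
Variables (R : comPzRingType) (r : nat) (A B : cx R r) (f : cxmor A B).
Variable i : int * int.

Fact cycle_map_subproof (z : cycle A i) : kerd (f i (cyc z)).
Proof. by rewrite /kerd -cxm_d (eqP (cycP z)) linear0. Qed.
Definition cycle_map (z : cycle A i) := Cycle (cycle_map_subproof z).

Fact cycle_map_linear : linear cycle_map.
Proof. by move=> a x y; apply: val_inj; rewrite /= linearP. Qed.
HB.instance Definition _ :=
  GRing.isLinear.Build R (cycle A i) (cycle B i) *:%R cycle_map cycle_map_linear.

Definition homology_map : homology A i -> homology B i :=
  qmap (boundary B i) cycle_map.

Lemma homology_mapE z :
  homology_map (qclass _ z) = qclass _ (cycle_map z).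
Proof.
apply: (qmapE (f := cycle_map)) => {}z /asboolP[j [e [y zE]]].
by apply/asboolP; exists j, e, (f j y); rewrite /= zE cxm_d.
Qed.

Lemma is_class_map x h : is_class x h -> is_class (f i x) (homology_map h).
Proof.
case=> xZ ->; rewrite homology_mapE; exists (cycle_map_subproof (Cycle xZ)).
by [].
Qed.

End HomologyMap.

Section ClassTheory.
Variables (R : comPzRingType) (r : nat) (A : cx R r) (i : int * int).

Lemma is_classP a (x y : A i) h k :
  is_class x h -> is_class y k -> is_class (a *: x + y) (a *: h + k).
Proof.
case=> xZ -> [yZ ->]; rewrite -linearP.
have zZ : kerd (a *: x + y) := valP (a *: Cycle xZ + Cycle yZ).
by exists zZ; congr (qclass _ _); apply: val_inj.
Qed.

Lemma is_class0 : is_class (0 : A i) 0.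
Proof.
have zZ : kerd (0 : A i) := valP (0 : cycle A i).
exists zZ; rewrite -(linear0 (qclass _)); congr (qclass _ _); exact: val_inj.
Qed.

Lemma is_class_cycle (x : A i) h j (e : j = i + bdeg r) :
  is_class x h -> cx_d A e x = 0.
Proof. by case=> /eqP xZ _; subst j. Qed.

Lemma is_class_d j (e : i = j + bdeg r) (y : A j) : is_class (cx_d A e y) 0.
Proof.
have zZ : kerd (cx_d A e y) by rewrite /kerd cx_dd.
exists zZ; rewrite -(linear0 (qclass _)); apply/qclass_eq.
by rewrite sub0r -scaleN1r; apply/rpredZ/asboolP; exists j, e, y.
Qed.

Lemma homology_map_id h : homology_map (cxid A) (i := i) h = h.
Proof.
have [z ->] := qclass_ex h; rewrite homology_mapE.
by congr (qclass _ _); apply: val_inj.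
Qed.

Lemma homology_map_comp (B C : cx R r) (g : cxmor B C) (f : cxmor A B) h :
  homology_map (cxcomp g f) (i := i) h = homology_map g (homology_map f h).
Proof.
have [z ->] := qclass_ex h; rewrite !homology_mapE.
by congr (qclass _ _); apply: val_inj.
Qed.

End ClassTheory.

(* [es_phi X r] is the characteristic map phi_(r+1). *)
Record espse (R : comPzRingType) := Espse {
  es_cx :> forall r, cx R r;
  es_phi : forall r i, {linear es_cx r.+1 i -> homology (es_cx r) i} }.

Arguments es_phi {R} _ r i.

Record esmor (R : comPzRingType) (X Y : espse R) := Esmor {
  esm :> forall r, cxmor (X r) (Y r);
  esm_phi : forall r i (x : X r.+1 i),
    es_phi Y r i (esm r.+1 i x) = homology_map (esm r) (es_phi X r i x) }.

Section ESpSe.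
Variable R : comPzRingType.

Lemma esmor_ext (X Y : espse R) (f g : esmor X Y) :
  (forall r i x, f r i x = g r i x) -> f = g.
Proof.
case: f g => f fd [g gd] /= fg.
have E : f = g by apply: functional_extensionality_dep => r; apply/cxmor_ext/fg.
by case: _ / E gd {fg} => gd; rewrite (Prop_irrelevance fd gd).
Qed.

Definition esid (X : espse R) : esmor X X :=
  @Esmor R X X (fun r => cxid (X r))
    (fun r i x => esym (homology_map_id (es_phi X r i x))).

Fact escomp_phi (X Y Z : espse R) (g : esmor Y Z) (f : esmor X Y) r i
    (x : X r.+1 i) :
  es_phi Z r i (cxcomp (g r.+1) (f r.+1) i x)
  = homology_map (cxcomp (g r) (f r)) (es_phi X r i x).
Proof. by rewrite homology_map_comp -!esm_phi. Qed.

Definition escomp (X Y Z : espse R) (g : esmor Y Z) (f : esmor X Y) :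
  esmor X Z := @Esmor R X Z (fun r => cxcomp (g r) (f r)) (escomp_phi g f).

Program Definition ESpSe : category :=
  @Category (espse R) (@esmor R) esid escomp _ _ _.
Next Obligation. by apply: esmor_ext. Qed.
Next Obligation. by apply: esmor_ext. Qed.
Next Obligation. by apply: esmor_ext. Qed.

End ESpSe.

Definition sdeg : int * int := (1, 1).

(* [lw_w L r] is the witness map w_(r+1) and [lw_s L r] is s_r. *)
Record lwb (R : comPzRingType) := Lwb {
  lw_cx :> forall r, cx R r;
  lw_w : forall r i, {linear lw_cx r.+1 i -> lw_cx r i};
  lw_s : forall r i j, j = i + sdeg -> {linear lw_cx r i -> lw_cx r.+1 j};
  lw_ws : forall r i j (e : j = i + sdeg) x, lw_w r j (lw_s r e x) = 0;
  lw_sw : forall r i j (e : j = i + sdeg) x, lw_s r e (lw_w r i x) = 0;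
  lw_wds : forall r i j k (e : j = i + bdeg r) (e1 : k = i + sdeg)
      (e2 : j = k + bdeg r.+1) (x : lw_cx r i),
    cx_d (lw_cx r) e x = lw_w r j (cx_d (lw_cx r.+1) e2 (lw_s r e1 x)) }.

Arguments lw_w {R} _ r i.
Arguments lw_s {R} _ r {i j} e.

Record lwmor (R : comPzRingType) (L M : lwb R) := Lwmor {
  lwm :> forall r, cxmor (L r) (M r);
  lwm_w : forall r i (x : L r.+1 i),
    lwm r i (lw_w L r i x) = lw_w M r i (lwm r.+1 i x);
  lwm_s : forall r i j (e : j = i + sdeg) (x : L r i),
    lwm r.+1 j (lw_s L r e x) = lw_s M r e (lwm r i x) }.

Section LWB.
Variable R : comPzRingType.

Lemma lwmor_ext (L M : lwb R) (f g : lwmor L M) :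
  (forall r i x, f r i x = g r i x) -> f = g.
Proof.
case: f g => f fw fs [g gw gs] /= fg.
have E : f = g by apply: functional_extensionality_dep => r; apply/cxmor_ext/fg.
case: _ / E gw gs {fg} => gw gs.
by rewrite (Prop_irrelevance fw gw) (Prop_irrelevance fs gs).
Qed.

Definition lwid (L : lwb R) : lwmor L L :=
  @Lwmor R L L (fun r => cxid (L r)) (fun r i x => erefl)
    (fun r i j e x => erefl).

Program Definition lwcomp (L M N : lwb R) (g : lwmor M N) (f : lwmor L M) :
  lwmor L N := @Lwmor R L N (fun r => cxcomp (g r) (f r)) _ _.
Next Obligation. by rewrite /= !lwm_w. Qed.
Next Obligation. by rewrite /= !lwm_s. Qed.

Program Definition LWB : category :=
  @Category (lwb R) (@lwmor R) lwid lwcomp _ _ _.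
Next Obligation. by apply: lwmor_ext. Qed.
Next Obligation. by apply: lwmor_ext. Qed.
Next Obligation. by apply: lwmor_ext. Qed.

End LWB.

(* [witn L j k] is the [j]-fold iterated witness map from [L_(j+k)] to [L_k]. *)
Fixpoint witn (R : comPzRingType) (L : lwb R) (j k : nat) (i : int * int) :
    L (j + k)%N i -> L k i :=
  match j return L (j + k)%N i -> L k i with
  | 0 => fun a => a
  | j'.+1 => fun a => witn (j := j') (lw_w L (j' + k) i a)
  end.
Arguments witn {R} L j k {i} a.

Section NerveModule.
Variables (R : comPzRingType) (X : espse R).

(* By definition of [is_class] this includes the condition [d_k x_k = 0]. *)
Definition compat (r : nat) (i : int * int)
    (x : forall k, (k <= r)%N -> X k i) :=
  forall k (h : (k < r)%N),
    is_class (x k (ltnW h)) (es_phi X k i (x k.+1 h)).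

(* As for maps of bidegree [bdeg r], the component [nx'] in degree
   [i + bdeg r] is given in every [j] equipped with [j = i + bdeg r]. *)
Record nerve_elt (r : nat) (i : int * int) := NerveElt {
  nx : forall k, (k <= r)%N -> X k i;
  nx' : forall j, j = i + bdeg r -> forall k, (k <= r)%N -> X k j;
  nxP : compat nx;
  nx'P : forall j (e : j = i + bdeg r), compat (nx' e);
  nx_d : forall j (e : j = i + bdeg r),
    cx_d (X r) e (nx (leqnn r)) = nx' e (leqnn r) }.

Lemma nerve_eltP r i (a b : nerve_elt r i) :
  (forall k h, @nx r i a k h = nx b h) ->
  (forall j (e : j = i + bdeg r) k h, @nx' r i a j e k h = nx' b e h) -> a = b.
Proof.
case: a b => x x' xP x'P xd [y y' yP y'P yd] /= xy xy'.
have E : x = y by do 2 apply: functional_extensionality_dep => ?; apply: xy.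
have E' : x' = y' by do 4 apply: functional_extensionality_dep => ?; apply: xy'.
subst y y'; rewrite (Prop_irrelevance xP yP) (Prop_irrelevance x'P y'P).
by rewrite (Prop_irrelevance xd yd).
Qed.

Lemma compat0 r i : compat (fun k (h : (k <= r)%N) => 0 : X k i).
Proof. by move=> k h; rewrite linear0; apply: is_class0. Qed.

Lemma compatP r i a (x y : forall k, (k <= r)%N -> X k i) :
  compat x -> compat y -> compat (fun k h => a *: x k h + y k h).
Proof. by move=> xP yP k h; rewrite linearP; apply: is_classP. Qed.

Lemma compatD r i (x y : forall k, (k <= r)%N -> X k i) :
  compat x -> compat y -> compat (fun k h => x k h + y k h).
Proof.
move=> xP yP k h; have := compatP 1 xP yP (k := k) h.
by rewrite !scale1r.
Qed.

Lemma compatZ r i a (x : forall k, (k <= r)%N -> X k i) :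
  compat x -> compat (fun k h => a *: x k h).
Proof.
move=> xP k h; have := compatP a xP (@compat0 r i) (k := k) h.
by rewrite !addr0.
Qed.

Lemma compatN r i (x : forall k, (k <= r)%N -> X k i) :
  compat x -> compat (fun k h => - x k h).
Proof.
by move=> /(compatZ (-1)) xP k h; have := xP k h; rewrite !scaleN1r.
Qed.

End NerveModule.

HB.instance Definition _ R X r i := gen_eqMixin (@nerve_elt R X r i).
HB.instance Definition _ R X r i := gen_choiceMixin (@nerve_elt R X r i).

Section NerveLmodule.
Variables (R : comPzRingType) (X : espse R) (r : nat) (i : int * int).
Local Notation N := (nerve_elt X r i).
Implicit Types a b c : N.

Program Definition nzero : N :=
  @NerveElt R X r i (fun _ _ => 0) (fun _ _ _ _ => 0) _ _ _.
Next Obligation. exact: compat0. Qed.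
Next Obligation. exact: compat0. Qed.
Next Obligation. by rewrite linear0. Qed.

Program Definition nadd a b : N :=
  @NerveElt R X r i (fun _ h => nx a h + nx b h)
    (fun _ e _ h => nx' a e h + nx' b e h) _ _ _.
Next Obligation. by apply: compatD; apply: nxP. Qed.
Next Obligation. by apply: compatD; apply: nx'P. Qed.
Next Obligation. by rewrite linearD !nx_d. Qed.

Program Definition nopp a : N :=
  @NerveElt R X r i (fun _ h => - nx a h) (fun _ e _ h => - nx' a e h) _ _ _.
Next Obligation. by apply: compatN; apply: nxP. Qed.
Next Obligation. by apply: compatN; apply: nx'P. Qed.
Next Obligation. by rewrite linearN !nx_d. Qed.

Program Definition nscale (t : R) a : N :=
  @NerveElt R X r i (fun _ h => t *: nx a h) (fun _ e _ h => t *: nx' a e h)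
    _ _ _.
Next Obligation. by apply: compatZ; apply: nxP. Qed.
Next Obligation. by apply: compatZ; apply: nx'P. Qed.
Next Obligation. by rewrite linearZ /= !nx_d. Qed.

Fact naddA : associative nadd.
Proof. by move=> a b c; apply: nerve_eltP => *; rewrite /= addrA. Qed.
Fact naddC : commutative nadd.
Proof. by move=> a b; apply: nerve_eltP => *; rewrite /= addrC. Qed.
Fact nadd0 : left_id nzero nadd.
Proof. by move=> a; apply: nerve_eltP => *; rewrite /= add0r. Qed.
Fact naddN : left_inverse nzero nopp nadd.
Proof. by move=> a; apply: nerve_eltP => *; rewrite /= addNr. Qed.
HB.instance Definition _ := GRing.isZmodule.Build N naddA naddC nadd0 naddN.

Fact nscaleA t u a : nscale t (nscale u a) = nscale (t * u) a.
Proof. by apply: nerve_eltP => *; rewrite /= scalerA. Qed.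
Fact nscale1 : left_id 1 nscale.
Proof. by move=> a; apply: nerve_eltP => *; rewrite /= scale1r. Qed.
Fact nscaleDr : right_distributive nscale +%R.
Proof. by move=> t a b; apply: nerve_eltP => *; rewrite /= scalerDr. Qed.
Fact nscaleDl a : {morph nscale^~ a : t u / t + u}.
Proof. by move=> t u; apply: nerve_eltP => *; rewrite /= scalerDl. Qed.
HB.instance Definition _ := GRing.Zmodule_isLmodule.Build R N
  nscaleA nscale1 nscaleDr nscaleDl.

Lemma nx_linear t a b k (h : (k <= r)%N) :
  nx (t *: a + b) h = t *: nx a h + nx b h.
Proof. by []. Qed.

Lemma nx'_linear t a b j (e : j = i + bdeg r) k (h : (k <= r)%N) :
  nx' (t *: a + b) e h = t *: nx' a e h + nx' b e h.
Proof. by []. Qed.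

End NerveLmodule.

(* The sequence (x_0, ..., x_r, 0) *)
Definition extend0 (R : comPzRingType) (X : espse R) (r : nat) (i : int * int)
    (x : forall k, (k <= r)%N -> X k i) k (h : (k <= r.+1)%N) : X k i :=
  match @idP (k <= r)%N with
  | ReflectT h' => x k h'
  | ReflectF _ => 0
  end.

Section NerveStructure.
Variables (R : comPzRingType) (X : espse R).

Lemma extend0_in r i (x : forall k, (k <= r)%N -> X k i) k (h : (k <= r.+1)%N)
  (h' : (k <= r)%N) : extend0 x h = x k h'.
Proof.
rewrite /extend0; case: {-}_ / idP => [h1|//].
by rewrite (bool_irrelevance h1 h').
Qed.

Lemma extend0_out r i (x : forall k, (k <= r)%N -> X k i) (h : (r.+1 <= r.+1)%N) :
  extend0 x h = 0.
Proof. by rewrite /extend0; case: {-}_ / idP => // h1; have := h1; rewrite ltnn. Qed.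

Lemma compat_extend0 r i (x : forall k, (k <= r)%N -> X k i) :
  compat x -> is_class (x r (leqnn r)) 0 -> compat (extend0 x).
Proof.
move=> xP xr k h; have [hk|hk] := ltnP k r.
  by rewrite (extend0_in _ _ (ltnW hk)) (extend0_in _ _ hk); apply: xP.
have E : k = r by apply/eqP; rewrite eqn_leq hk andbT -ltnS.
by subst k; rewrite (extend0_in _ _ (leqnn r)) extend0_out linear0.
Qed.

Lemma compat_restrict r i (x : forall k, (k <= r.+1)%N -> X k i) :
  compat x -> compat (fun k (h : (k <= r)%N) => x k (leqW h)).
Proof.
move=> xP k h; have := xP k (leqW h).
by rewrite (bool_irrelevance (ltnW (leqW h)) (leqW (ltnW h))).
Qed.

Section Differential.
Variables (r : nat) (i j : int * int) (e : j = i + bdeg r).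

Program Definition nerve_d_fun (a : nerve_elt X r i) : nerve_elt X r j :=
  @NerveElt R X r j (nx' a e) (fun _ _ _ _ => 0) _ _ _.
Next Obligation. exact: nx'P. Qed.
Next Obligation. exact: compat0. Qed.
Next Obligation. by rewrite -nx_d cx_dd. Qed.

Fact nerve_d_linear : linear nerve_d_fun.
Proof.
move=> t a b; apply: nerve_eltP => [//|j' e' k h].
by rewrite nx'_linear /= scaler0 addr0.
Qed.

Definition nerve_d := mklin nerve_d_linear.
End Differential.

Fact nerve_dd r i j k (e : j = i + bdeg r) (e' : k = j + bdeg r) a :
  nerve_d e' (nerve_d e a) = 0.
Proof. exact: nerve_eltP. Qed.

Definition nerve_cx r : cx R r :=
  @Cx R r (fun i => nerve_elt X r i : lmodType R) (@nerve_d r) (@nerve_dd r).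

Section Witness.
Variables (r : nat) (i : int * int).

Program Definition nerve_w_fun (a : nerve_elt X r.+1 i) : nerve_elt X r i :=
  @NerveElt R X r i (fun _ h => nx a (leqW h)) (fun _ _ _ _ => 0) _ _ _.
Next Obligation. exact: (compat_restrict (nxP a)). Qed.
Next Obligation. exact: compat0. Qed.
Next Obligation.
have := is_class_cycle e (nxP a (leqnn r.+1)).
by rewrite (bool_irrelevance (ltnW _) (leqW (leqnn r))).
Qed.

Fact nerve_w_linear : linear nerve_w_fun.
Proof.
move=> t a b; apply: nerve_eltP => [//|j e k h].
by rewrite nx'_linear /= scaler0 addr0.
Qed.

Definition nerve_w := mklin nerve_w_linear.
End Witness.

Section Degeneracy.
Variables (r : nat) (i j : int * int) (e : j = i + sdeg).

Fact bdegS k : k = j + bdeg r.+1 -> k = i + bdeg r.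
Proof.
move=> ->; rewrite e -addrA; congr (_ + _).
rewrite /bdeg /sdeg; congr (_, _) => /=.
  by rewrite -addn1 PoszD opprD addrCA subrr addr0.
by rewrite -addn1 PoszD opprD (addrC (- r%:Z)) addNKr.
Qed.

Program Definition nerve_s_fun (a : nerve_elt X r i) : nerve_elt X r.+1 j :=
  @NerveElt R X r.+1 j (fun _ _ => 0)
    (fun k e' => extend0 (nx' a (bdegS e'))) _ _ _.
Next Obligation. exact: compat0. Qed.
Next Obligation.
apply: compat_extend0; first exact: nx'P.
by rewrite -nx_d; apply: is_class_d.
Qed.
Next Obligation. by rewrite linear0 extend0_out. Qed.

Fact nerve_s_linear : linear nerve_s_fun.
Proof.
move=> t a b; apply: nerve_eltP => [k h|k e' l h].
  by rewrite nx_linear /= scaler0 addr0.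
rewrite nx'_linear /= /extend0; case: {-}_ / idP => // _.
by rewrite scaler0 addr0.
Qed.

Definition nerve_s := mklin nerve_s_linear.
End Degeneracy.

Fact nerve_ws r i j (e : j = i + sdeg) a : nerve_w r j (nerve_s r e a) = 0.
Proof. exact: nerve_eltP. Qed.

Fact nerve_sw r i j (e : j = i + sdeg) a : nerve_s r e (nerve_w r i a) = 0.
Proof.
apply: nerve_eltP => //= k e' l h.
by rewrite /extend0; case: {-}_ / idP.
Qed.

Fact nerve_wds r i j k (e : j = i + bdeg r) (e1 : k = i + sdeg)
    (e2 : j = k + bdeg r.+1) (a : nerve_elt X r i) :
  nerve_d e a = nerve_w r j (nerve_d e2 (nerve_s r e1 a)).
Proof.
apply: nerve_eltP => //= l h; rewrite (extend0_in _ _ h).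
by rewrite (eq_irrelevance e (bdegS e1 e2)).
Qed.

Definition nerve_ob : lwb R :=
  @Lwb R nerve_cx nerve_w nerve_s nerve_ws nerve_sw nerve_wds.

End NerveStructure.

Section NerveFunctor.
Variable R : comPzRingType.

Lemma compat_map (X Y : espse R) (f : esmor X Y) r i
    (x : forall k, (k <= r)%N -> X k i) :
  compat x -> compat (fun k h => f k i (x k h)).
Proof. by move=> xP k h; rewrite esm_phi; apply/is_class_map/xP. Qed.

Section Map.
Variables (X Y : espse R) (f : esmor X Y).

Program Definition nerve_map_fun r i (a : nerve_elt X r i) : nerve_elt Y r i :=
  @NerveElt R Y r i (fun k h => f k i (nx a h))
    (fun j e k h => f k j (nx' a e h)) _ _ _.
Next Obligation. exact: (compat_map f (nxP a)). Qed.
Next Obligation. exact: (compat_map f (nx'P a e)). Qed.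
Next Obligation. by rewrite -cxm_d nx_d. Qed.

Fact nerve_map_linear r i : linear (@nerve_map_fun r i).
Proof. by move=> t a b; apply: nerve_eltP => *; rewrite /= linearP. Qed.

Fact nerve_map_d r i j (e : j = i + bdeg r) a :
  mklin (@nerve_map_linear r j) (cx_d (nerve_cx X r) e a)
  = cx_d (nerve_cx Y r) e (mklin (@nerve_map_linear r i) a).
Proof. by apply: nerve_eltP => *; rewrite //= linear0. Qed.

Definition nerve_map_cx r : cxmor (nerve_ob X r) (nerve_ob Y r) :=
  @Cxmor R r (nerve_cx X r) (nerve_cx Y r)
    (fun i => mklin (@nerve_map_linear r i)) (@nerve_map_d r).

Fact nerve_map_w r i (a : nerve_ob X r.+1 i) :
  nerve_map_cx r i (lw_w (nerve_ob X) r i a)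
  = lw_w (nerve_ob Y) r i (nerve_map_cx r.+1 i a).
Proof. by apply: nerve_eltP => *; rewrite //= linear0. Qed.

Fact nerve_map_s r i j (e : j = i + sdeg) (a : nerve_ob X r i) :
  nerve_map_cx r.+1 j (lw_s (nerve_ob X) r e a)
  = lw_s (nerve_ob Y) r e (nerve_map_cx r i a).
Proof.
apply: nerve_eltP => [k h|k e' l h] /=; first by rewrite linear0.
by rewrite /extend0; case: {-}_ / idP => // _; rewrite linear0.
Qed.

Definition nerve_map : lwmor (nerve_ob X) (nerve_ob Y) :=
  @Lwmor R _ _ nerve_map_cx nerve_map_w nerve_map_s.

End Map.

Program Definition nerve : functor (ESpSe R) (LWB R) :=
  @Functor (ESpSe R) (LWB R) (@nerve_ob R) nerve_map _ _.
Next Obligation. by apply: lwmor_ext => r i x; apply: nerve_eltP. Qed.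
Next Obligation. by apply: lwmor_ext => r i x; apply: nerve_eltP. Qed.

End NerveFunctor.

Record subcx (R : comPzRingType) (r : nat) (A : cx R r) := Subcx {
  sub_mod :> forall i, submodClosed (A i);
  sub_d : forall i j (e : j = i + bdeg r) x,
    x \in sub_mod i -> cx_d A e x \in sub_mod j }.

Section QuotientComplex.
Variables (R : comPzRingType) (r : nat) (A : cx R r) (S : subcx A).

Definition quotcx_d i j (e : j = i + bdeg r) :
    {linear quotmod (S i) -> quotmod (S j)} :=
  mklin (qmap_linear (fun x => sub_d (s := S) e (x := x))).

Lemma quotcx_dE i j (e : j = i + bdeg r) x :
  quotcx_d e (qclass (S i) x) = qclass (S j) (cx_d A e x).
Proof. exact: qmapE (fun x => sub_d (s := S) e (x := x)) x. Qed.

Fact quotcx_dd i j k (e : j = i + bdeg r) (e' : k = j + bdeg r) q :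
  quotcx_d e' (quotcx_d e q) = 0.
Proof.
by have [x ->] := qclass_ex q; rewrite !quotcx_dE cx_dd linear0.
Qed.

Definition quotcx : cx R r :=
  @Cx R r (fun i => quotmod (S i) : lmodType R) quotcx_d quotcx_dd.

End QuotientComplex.

Section DegenerateSubcomplex.
Variables (R : comPzRingType) (L : lwb R) (r : nat).

(* [Spred] is S_(r+1)(L) = s_r L_r + d_(r+1) s_r L_r *)
Definition Spred (i : int * int) : L r.+1 i -> bool := fun x =>
  `[< exists j (e : i = j + sdeg) (b : L r j)
        k l (e1 : l = k + sdeg) (e2 : i = l + bdeg r.+1) (c : L r k),
      x = lw_s L r e b + cx_d (L r.+1) e2 (lw_s L r e1 c) >].

Fact Spred_closed i : submod_closed (@Spred i).
Proof.
split=> [|t x y /asboolP[j [e [b [k [l [e1 [e2 [c ->]]]]]]]]].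
  apply/asboolP; exists (i - sdeg), (esym (subrK _ _)), 0.
  exists (i - bdeg r.+1 - sdeg), (i - bdeg r.+1), (esym (subrK _ _)).
  by exists (esym (subrK _ _)), 0; rewrite !linear0 addr0.
case/asboolP=> [j' [e' [b' [k' [l' [e1' [e2' [c' ->]]]]]]]]; apply/asboolP.
have ej : j = j' by apply: (addIr sdeg); rewrite -e.
have el : l = l' by apply: (addIr (bdeg r.+1)); rewrite -e2.
case: _ / ej b' e' => b' e'; case: _ / el e1' e2' => e1' e2'.
have ek : k = k' by apply: (addIr sdeg); rewrite -e1.
case: _ / ek c' e1' => c' e1'; rewrite (eq_irrelevance e' e) (eq_irrelevance e1' e1).
rewrite (eq_irrelevance e2' e2).
exists j, e, (t *: b + b'), k, l, e1, e2, (t *: c + c').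
by rewrite !linearP scalerDr addrACA.
Qed.
Definition Smod i : submodClosed (L r.+1 i) :=
  HB.pack_for (submodClosed (L r.+1 i)) (@Spred i)
    (GRing.isSubmodClosed.Build R (L r.+1 i) (@Spred i) (@Spred_closed i)).

Fact Spred_d i j (e : j = i + bdeg r.+1) x :
  x \in Smod i -> cx_d (L r.+1) e x \in Smod j.
Proof.
case/asboolP=> [k [e0 [b [l [m [e1 [e2 [c ->]]]]]]]]; apply/asboolP.
exists (j - sdeg), (esym (subrK _ _)), 0, k, i, e0, e, b.
by rewrite linearD cx_dd linear0 addr0 add0r.
Qed.

Definition Ssub : subcx (L r.+1) :=
  @Subcx R r.+1 (L r.+1) Smod Spred_d.

End DegenerateSubcomplex.

Definition Qcx (R : comPzRingType) (L : lwb R) (r : nat) : cx R r :=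
  match r with
  | 0 => L 0%N
  | r'.+1 => quotcx (Ssub L r')
  end.

Definition bar (R : comPzRingType) (L : lwb R) (r : nat) (i : int * int) :
    L r i -> Qcx L r i :=
  match r return L r i -> Qcx L r i with
  | 0 => fun a => a
  | r'.+1 => fun a => qclass (Ssub L r' i) a
  end.
Arguments bar {R} L r {i} a.

Lemma bar_d (R : comPzRingType) (L : lwb R) r i j (e : j = i + bdeg r) a :
  cx_d (Qcx L r) e (bar L r a) = bar L r (cx_d (L r) e a).
Proof. by case: r e a => [//|r] e a; apply: quotcx_dE. Qed.

Definition Qob (R : comPzRingType)
    (phi : forall (L : lwb R) r i,
      {linear Qcx L r.+1 i -> homology (Qcx L r) i}) (L : lwb R) : espse R :=
  @Espse R (Qcx L) (phi L).

(* Main.v *)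
Require Import Defs.
From HB Require Import structures.
From mathcomp Require Import all_boot all_order all_algebra.
From mathcomp Require Import boolp.

Set Implicit Arguments.
Unset Strict Implicit.
Unset Printing Implicit Defensive.

Import GRing.Theory.
Local Open Scope ring_scope.

(** Everything rests on one identification: the degenerate part S_r of a nerve
    N(X)_r is exactly the set of elements (x; x') whose top entry x_r vanishes
    ([top_ker] and [nerve_top0]).  One inclusion is a glance at s and d s.  For
    the other, in N(X)_(r+1), [x_r] = phi(x_(r+1)) = 0, so x_r = d y for some y,
    and likewise x'_(r+1) = d x_(r+1) = 0 forces x'_r = d y'.  Each of y and y'
    can be continued downwards to a compatible sequence by choosing
    representatives of characteristic classes; this yields elements c and b of
    N(X)_r with c' = (x_0, ..., x_r) and b' = (x'_0, ..., x'_r), and then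
    (x; x') = s b + d s c.

    Hence the projection to the top entry induces an injective map
    QN(X)_r -> X_r.  It is surjective because any x_r, together with d x_r, can
    be continued downwards in the same way.  So the counit is an isomorphism,
    which for formal reasons makes N fully faithful and Q essentially
    surjective ([counit_iso_fully_faithful],
    [counit_iso_essentially_surjective]).

    The map phi on Q(L) is well defined because d w = w d s w = 0 makes w(a) a
    cycle, while w s = 0 and w d s = d make w send S_(r+1) to boundaries.  With
    phi(bar a) = [bar (w a)], iterating w and taking classes produces compatible
    sequences, which gives the unit; the triangle identities say that the top
    entry of eta(a) is bar a and that the top entry of w^j(x; x') is x_(r-j).

    The unit is surjective by induction on r: given b in NQ(L)_(r+1), lift its
    top entry to a in L_(r+1); then b - eta(a) has top entry 0, so equals
    s b1 + d s c1 with b1 and c1 in NQ(L)_r, and these are in the image of eta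
    by induction.

    Two tools recur.  Linear maps out of Q(L)_r are obtained by factoring a map
    on L_r through the surjection [bar] ([factor]), which treats r = 0 and r > 0
    alike.  Descending sequences x_r, p x_r, p (p x_r), ..., with p either w or
    a choice of representatives, are given by [tower]. *)

(** * Descending sequences *)

Section Tower.
Variables (T : nat -> Type) (p : forall r, T r.+1 -> T r).

Lemma leq_of_leqS_neq k r : (k <= r.+1)%N -> k <> r.+1 -> (k <= r)%N.
Proof. by rewrite leq_eqVlt => /orP[/eqP|]. Qed.

(** Appends [t] to the sequence [x]; the entry [k = r.+1] is recognised up to a
    cast because [T] depends on the index. *)
Definition extend r (x : forall k, (k <= r)%N -> T k) (t : T r.+1) k
    (h : (k <= r.+1)%N) : T k :=
  match k =P r.+1 with
  | ReflectT e => ecast m (T m) (esym e) t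
  | ReflectF ne => x k (leq_of_leqS_neq h ne)
  end.

(** The sequence ending with [a] whose other entries are the iterates of [p].
    Recursion on [r] avoids writing [r] as [j + k], with its casts. *)
Fixpoint tower r : T r -> forall k, (k <= r)%N -> T k :=
  match r return T r -> forall k, (k <= r)%N -> T k with
  | 0 => fun a k => match k return (k <= 0)%N -> T k with
                    | 0 => fun=> a
                    | _.+1 => fun h => match notF h with end
                    end
  | r'.+1 => fun a => extend (tower (p a)) a
  end.

Lemma tower_top r (a : T r) (h : (r <= r)%N) : tower a h = a.
Proof.
case: r a h => //= r a h; rewrite /extend; case: eqP => // e.
by rewrite (eq_irrelevance e erefl).
Qed.

Lemma towerS r (a : T r.+1) k (h : (k <= r.+1)%N) (h' : (k <= r)%N) :
  tower a h = tower (p a) h'.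
Proof.
rewrite /= /extend; case: eqP => [e|ne]; last first.
  by congr tower; apply: bool_irrelevance.
by exfalso; move: h'; rewrite e ltnn.
Qed.

(** The compatibility conditions of a nerve relate entries [k] and [k.+1]; this
    is the form in which a tower meets them. *)
Lemma tower_step r (a : T r) k (h : (k < r)%N) (h' : (k <= r)%N) :
  tower a h' = p (tower a h).
Proof.
elim: r a k h h' => // r IH a k h h'.
have [e|ne] := k =P r.
  by subst k; rewrite tower_top (towerS a h' (leqnn r)) tower_top.
have hk : (k < r)%N by apply: leq_of_leqS_neq => // -[].
by rewrite (towerS a h hk) (towerS a h' (ltnW hk)); apply: IH.
Qed.

End Tower.

Local Arguments tower [T] p [r] a [k] h : simpl never.

Lemma tower_map (T U : nat -> Type) (p : forall r, T r.+1 -> T r)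
    (q : forall r, U r.+1 -> U r) (f : forall r, T r -> U r) :
  (forall r x, f r (p r x) = q r (f r.+1 x)) ->
  forall r (a : T r) k (h : (k <= r)%N),
  f k (tower p a h) = tower q (f r a) h.
Proof.
move=> fpq; elim=> [|r IH] a k h.
  by case: k h => // h; rewrite !tower_top.
have [e|ne] := k =P r.+1; first by subst k; rewrite !tower_top.
by have h' := leq_of_leqS_neq h ne; rewrite !(towerS _ _ h h') IH fpq.
Qed.

(** * Linear maps out of a quotient *)

Section Factor.
Variables (R : pzRingType) (V W U : lmodType R).
Variables (p : V -> W) (f : {linear V -> U}).
Hypotheses (p_lin : linear p) (p_surj : forall y, exists x, p x = y).
Hypothesis ker_pf : forall x, p x = 0 -> f x = 0.

(** A preimage under [p] is picked for every element of [W]; two preimages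
    differ by an element of the kernel of [p], so the choice is immaterial. *)
Fact factor_subproof : {g : {linear W -> U} | forall x, g (p x) = f x}.
Proof.
pose g y := f (projT1 (cid (p_surj y))).
have gp x : g (p x) = f x.
  rewrite /g; case: cid => z /= pz.
  apply/eqP; rewrite -subr_eq0 -linearB; apply/eqP/ker_pf.
  by rewrite [LHS](linearB (mklin p_lin)) /= pz subrr.
have g_lin : linear g.
  move=> t y y'; have [x <-] := p_surj y; have [x' <-] := p_surj y'.
  by rewrite -p_lin !gp linearP.
by exists (mklin g_lin).
Qed.

Definition factor : {linear W -> U} := sval factor_subproof.

Lemma factorE x : factor (p x) = f x.
Proof. exact: (svalP factor_subproof). Qed.

End Factor.

(** * Adjunctions with invertible counit *)

Section Category.
Variables (C D : category) (F : functor C D) (G : functor D C).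
Variable adj : adjunction F G.
Hypothesis counit_iso : forall b, is_iso (adj_counit adj b).

Lemma counit_iso_essentially_surjective : essentially_surjective F.
Proof. by move=> b; exists (G b), (adj_counit adj b). Qed.

(** The triangle identity G(eps) eta_G = 1 shows that eta_(G a) is inverse to
    G(eps_a).  The inverse of f |-> G f sends h to eps_b . F h . eps_a^-1. *)
Lemma counit_iso_fully_faithful : fully_faithful G.
Proof.
move=> a b; have [g [gl gr]] := counit_iso a.
have Gg : fmap G g = adj_unit adj (G a).
  rewrite -[LHS]comp_idr -(triangleG adj a) Defs.compA -fmap_comp gl fmap_id.
  exact: comp_idl.
exists (fun h => compm (compm (adj_counit adj b) (fmap F h)) g) => [f|h].
  by rewrite counit_nat -Defs.compA gr comp_idr.
rewrite !fmap_comp Gg -Defs.compA unit_nat Defs.compA.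
by rewrite triangleG comp_idl.
Qed.

End Category.

(** * Isomorphisms of extended spectral sequences *)

Section EspseIso.
Variables (R : comPzRingType) (X Y : espse R) (f : esmor X Y).
Hypothesis f_inj : forall r i x, f r i x = 0 -> x = 0.
Hypothesis f_surj : forall r i y, exists x, f r i x = y.

(* Injectivity lets the identity factor through f, which gives the inverse. *)
Let finv r i : {linear Y r i -> X r i} :=
  factor (f := idfun) (linearP (f r i)) (@f_surj r i) (@f_inj r i).

Let finvK r i x : finv r i (f r i x) = x.
Proof. exact: factorE. Qed.

Let finv_d r i j (e : j = i + bdeg r) y :
  finv r j (cx_d (Y r) e y) = cx_d (X r) e (finv r i y).
Proof. by have [x <-] := f_surj y; rewrite -cxm_d finvK (finvK x). Qed.

Let finv_cx r := @Cxmor R r (Y r) (X r) (finv r) (@finv_d r).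

Let finv_phi r i (y : Y r.+1 i) :
  es_phi X r i (finv_cx r.+1 i y) = homology_map (finv_cx r) (es_phi Y r i y).
Proof.
have [x <-] := f_surj y; rewrite esm_phi -homology_map_comp.
(* By functoriality H(g) H(f) = H(g f), and g f is the identity. *)
rewrite (finvK x : finv_cx r.+1 i _ = _) -[LHS]homology_map_id.
suff -> : cxcomp (finv_cx r) (f r) = cxid (X r) by [].
by apply: cxmor_ext => j z; apply: finvK.
Qed.

Lemma bijective_is_iso : @is_iso (ESpSe R) X Y f.
Proof.
exists (Esmor finv_phi); split; apply: esmor_ext => r i x; first exact: finvK.
by have [y <-] := f_surj x; congr (f r i _); apply: finvK.
Qed.

End EspseIso.

(** * Homology classes *)

Lemma is_class_unique (R : comPzRingType) r (A : cx R r) i (x : A i) h k :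
  is_class x h -> is_class x k -> h = k.
Proof.
by case=> xZ -> [xZ' ->]; congr (qclass _ _); apply: val_inj.
Qed.

Lemma is_class0_ex (R : comPzRingType) r (A : cx R r) i (x : A i) :
  is_class x 0 -> exists j (e : i = j + bdeg r) y, x = cx_d A e y.
Proof.
case=> xZ /esym; rewrite -(linear0 (qclass _)) => /qclass_eq.
by rewrite subr0 => /asboolP.
Qed.

Lemma is_class_ex (R : comPzRingType) r (A : cx R r) i (h : homology A i) :
  exists x, is_class x h.
Proof. by have [[x xZ] ->] := qclass_ex h; exists x, xZ. Qed.

(** * The quotient by the degenerate part and its characteristic map *)

Local Arguments bar {R} L r {i} a : simpl never.

Section QuotientBySTheory.
Variable R : comPzRingType.

Lemma bar_linear (L : lwb R) r i : linear (@bar R L r i).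
Proof. by case: r => [//|r] a x y; apply: qclass_linear. Qed.

Lemma bar_surj (L : lwb R) r i (q : Qcx L r i) : exists a, bar L r a = q.
Proof.
case: r q => [|r] q; first by exists q.
by have [a ->] := qclass_ex q; exists a.
Qed.

Lemma bar0 (L : lwb R) r i : bar L r (0 : L r i) = 0.
Proof. exact: (linear0 (mklin (@bar_linear L r i))). Qed.

Lemma barD (L : lwb R) r i (a b : L r i) :
  bar L r (a + b) = bar L r a + bar L r b.
Proof. exact: (linearD (mklin (@bar_linear L r i))). Qed.

Lemma barS_eq0 (L : lwb R) r i (a : L r.+1 i) :
  bar L r.+1 a = 0 <-> a \in Ssub L r i.
Proof. by rewrite -(@bar0 L r.+1 i) -{2}(subr0 a); apply: qclass_eq. Qed.

Lemma bar_s (L : lwb R) r i j (e : j = i + sdeg) (a : L r i) :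
  bar L r.+1 (lw_s L r e a) = 0.
Proof.
apply/barS_eq0/asboolP; exists i, e, a.
exists (j - bdeg r.+1 - sdeg), (j - bdeg r.+1), (esym (subrK _ _)).
by exists (esym (subrK _ _)), 0; rewrite !linear0 addr0.
Qed.

Lemma bar_ds (L : lwb R) r i j k (e : j = i + sdeg) (e' : k = j + bdeg r.+1)
    (a : L r i) :
  bar L r.+1 (cx_d (L r.+1) e' (lw_s L r e a)) = 0.
Proof. by rewrite -bar_d bar_s linear0. Qed.

(** To factor through [bar] it suffices to kill s b + d s c; for r = 0, where
    [bar] is the identity, only 0 has to be killed. *)
Lemma bar_eq0_ind (L : lwb R) (P : forall r i, L r i -> Prop) :
  (forall r i, P r i 0) ->
  (forall r i j (e : i = j + sdeg) (b : L r j)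
      k l (e1 : l = k + sdeg) (e2 : i = l + bdeg r.+1) (c : L r k),
    P r.+1 i (lw_s L r e b + cx_d (L r.+1) e2 (lw_s L r e1 c))) ->
  forall r i (a : L r i), bar L r a = 0 -> P r i a.
Proof.
move=> P0 PS [|r] i a; first by rewrite /bar => ->.
by case/barS_eq0/asboolP=> j [e [b [k [l [e1 [e2 [c ->]]]]]]].
Qed.

(** Since d = w d s, already d w = w d (s w) = 0 before passing to quotients. *)
Lemma d_w (L : lwb R) r i j (e : j = i + bdeg r) (a : L r.+1 i) :
  cx_d (L r) e (lw_w L r i a) = 0.
Proof.
have e2 : j = i + sdeg + bdeg r.+1 by rewrite e (bdegS erefl erefl).
by rewrite (@lw_wds _ _ _ _ _ _ e erefl e2) lw_sw !linear0.
Qed.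

Section Characteristic.
Variables (L : lwb R) (r : nat) (i : int * int).

Fact bar_w_cycle (a : L r.+1 i) : kerd (bar L r (lw_w L r i a)).
Proof. by rewrite /kerd bar_d d_w bar0. Qed.

Definition w_class (a : L r.+1 i) : homology (Qcx L r) i :=
  qclass _ (Cycle (bar_w_cycle a)).

Fact w_class_linear : linear w_class.
Proof.
move=> t a b; rewrite -linearP; congr (qclass _ _); apply: val_inj.
by rewrite /= linearP bar_linear.
Qed.

Lemma is_class_w_class a : is_class (bar L r (lw_w L r i a)) (w_class a).
Proof. by exists (bar_w_cycle a). Qed.

(** As w s = 0 and w d s = d, w maps s b + d s c to the boundary d c. *)
Fact w_class_ker a : bar L r.+1 a = 0 -> mklin w_class_linear a = 0.
Proof.
case/barS_eq0/asboolP=> j [e [b [k [l [e1 [e2 [c ->]]]]]]].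
apply: is_class_unique (is_class_w_class _) _.
rewrite linearD lw_ws add0r -(lw_wds (bdegS e1 e2)) -bar_d.
exact: is_class_d.
Qed.

Definition Q_phi : {linear Qcx L r.+1 i -> homology (Qcx L r) i} :=
  factor (@bar_linear L r.+1 i) (@bar_surj L r.+1 i) w_class_ker.

Lemma is_class_Q_phi a :
  is_class (bar L r (lw_w L r i a)) (Q_phi (bar L r.+1 a)).
Proof. by rewrite /Q_phi factorE; apply: is_class_w_class. Qed.

End Characteristic.
End QuotientBySTheory.

(** * Functoriality of the quotient *)

Section Reflection.
Variable R : comPzRingType.

Section QMap.
Variables (L M : lwb R) (f : lwmor L M).

Fact bar_map_linear r i : linear (fun a : L r i => bar M r (f r i a)).
Proof. by move=> t a b; rewrite linearP bar_linear. Qed.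

Fact bar_map_ker r i (a : L r i) :
  bar L r a = 0 -> mklin (@bar_map_linear r i) a = 0.
Proof.
elim/bar_eq0_ind: r i a /; first by move=> r i; apply: linear0.
move=> r i j e b k l e1 e2 c.
by rewrite /= linearD barD cxm_d !lwm_s bar_s bar_ds addr0.
Qed.

Definition Qmap_lin r i : {linear Qcx L r i -> Qcx M r i} :=
  factor (@bar_linear R L r i) (@bar_surj R L r i) (@bar_map_ker r i).

Lemma Qmap_bar r i (a : L r i) : Qmap_lin r i (bar L r a) = bar M r (f r i a).
Proof. exact: factorE. Qed.

Fact Qmap_d r i j (e : j = i + bdeg r) q :
  Qmap_lin r j (cx_d (Qcx L r) e q) = cx_d (Qcx M r) e (Qmap_lin r i q).
Proof. by have [a <-] := bar_surj q; rewrite bar_d !Qmap_bar cxm_d bar_d. Qed.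

Definition Qmap_cx r : cxmor (Qcx L r) (Qcx M r) := Cxmor (@Qmap_d r).

Fact Qmap_phi r i (q : Qob (@Q_phi R) L r.+1 i) :
  es_phi (Qob (@Q_phi R) M) r i (Qmap_cx r.+1 i q)
  = homology_map (Qmap_cx r) (es_phi (Qob (@Q_phi R) L) r i q).
Proof.
have [a <-] := bar_surj q; rewrite (Qmap_bar a : Qmap_cx r.+1 i _ = _).
apply: is_class_unique (is_class_Q_phi _) _; rewrite -lwm_w -Qmap_bar.
exact: (is_class_map (Qmap_cx r)) (is_class_Q_phi a).
Qed.

Definition Qmap : esmor (Qob (@Q_phi R) L) (Qob (@Q_phi R) M) :=
  @Esmor R (Qob (@Q_phi R) L) (Qob (@Q_phi R) M) Qmap_cx Qmap_phi.

Lemma QmapE r i (a : L r i) : Qmap r i (bar L r a) = bar M r (f r i a).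
Proof. exact: Qmap_bar. Qed.

End QMap.

Local Notation Q := (Qob (@Q_phi R)).

(** The classes [bar L r a] exhaust the quotient, so every identity between
    morphisms out of it is checked on them. *)
Lemma Qmor_ext (L : lwb R) (X : espse R) (g h : esmor (Q L) X) :
  (forall r i (a : L r i), g r i (bar L r a) = h r i (bar L r a)) -> g = h.
Proof.
by move=> gh; apply: esmor_ext => r i q; have [a <-] := bar_surj q; apply: gh.
Qed.

Lemma Qmap_id (L : LWB R) :
  Qmap (idm L) = @idm (ESpSe R) (Q L) :> @mor (ESpSe R) (Q L) (Q L).
Proof. by apply: Qmor_ext => r i a; rewrite QmapE. Qed.

Lemma Qmap_comp (L M N : LWB R) (g : mor M N) (f : mor L M) :
  Qmap (compm g f) = @compm (ESpSe R) (Q L) (Q M) (Q N) (Qmap g) (Qmap f).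
Proof. by apply: Qmor_ext => r i a; rewrite QmapE /= !QmapE. Qed.

(** * The counit and its invertibility *)

Section Counit.
Variable X : espse R.
Local Notation NX := (nerve_ob X).

Fact top_linear r i : linear (fun a : nerve_elt X r i => nx a (leqnn r)).
Proof. by []. Qed.

(** The easy half of the description of S_r: both s b and d s c have top entry
    0, the latter because s pads c' by a zero. *)
Fact top_ker r i (a : NX r i) : bar NX r a = 0 -> mklin (@top_linear r i) a = 0.
Proof.
elim/bar_eq0_ind: r i a /; first by move=> r i; apply: linear0.
move=> r i j e b k l e1 e2 c; rewrite linearD.
by rewrite /= add0r extend0_out.
Qed.

Definition counit_lin r i : {linear Qcx NX r i -> X r i} :=
  factor (@bar_linear R NX r i) (@bar_surj R NX r i) (@top_ker r i).

Lemma counit_bar r i (a : NX r i) :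
  counit_lin r i (bar NX r a) = nx a (leqnn r).
Proof. exact: factorE. Qed.

Fact counit_d r i j (e : j = i + bdeg r) q :
  counit_lin r j (cx_d (Qcx NX r) e q) = cx_d (X r) e (counit_lin r i q).
Proof. by have [a <-] := bar_surj q; rewrite bar_d !counit_bar nx_d. Qed.

Definition counit_cx r : cxmor (Qcx NX r) (X r) := Cxmor (@counit_d r).

Fact counit_phi r i (q : Q NX r.+1 i) :
  es_phi X r i (counit_cx r.+1 i q)
  = homology_map (counit_cx r) (es_phi (Q NX) r i q).
Proof.
have [a <-] := bar_surj q; rewrite (counit_bar a : counit_cx r.+1 i _ = _).
apply: is_class_unique (nxP a (leqnn r.+1)) _.
have := is_class_map (counit_cx r) (is_class_Q_phi a).
rewrite (counit_bar _ : counit_cx r i _ = _) /=.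
by rewrite (bool_irrelevance (leqW _) (ltnW (leqnn r.+1))).
Qed.

Definition counit : esmor (Q NX) X := @Esmor R (Q NX) X counit_cx counit_phi.

Lemma counitE r i (a : NX r i) : counit r i (bar NX r a) = nx a (leqnn r).
Proof. exact: counit_bar. Qed.

Definition repr_phi i r (x : X r.+1 i) : X r i :=
  projT1 (cid (is_class_ex (es_phi X r i x))).

Lemma is_class_repr_phi i r (x : X r.+1 i) :
  is_class (repr_phi x) (es_phi X r i x).
Proof. by rewrite /repr_phi; case: cid. Qed.

Lemma compat_tower r i (x : X r i) :
  compat (fun k => tower (@repr_phi i) x (k := k)).
Proof. by move=> k h; rewrite (tower_step _ _ h); apply: is_class_repr_phi. Qed.

(** The entries below the top of the unprimed half are free up to compatibility,
    so an element can be found with any top entry [y] and any compatible primed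
    half ending with [d y]. *)
Lemma nerve_elt_ex r i j (e : j = i + bdeg r) (y : X r i)
    (y' : forall k, (k <= r)%N -> X k j) :
  compat y' -> cx_d (X r) e y = y' r (leqnn r) ->
  exists b : nerve_elt X r i, nx b (leqnn r) = y /\
    forall k h, nx' b e h = y' k h.
Proof.
move: y'; subst j => y' y'P dy.
(* The primed half is a family over all degrees equal to j, hence the cast. *)
pose z j (e : j = i + bdeg r) :=
  ecast m (forall k, (k <= r)%N -> X k m) (esym e) y'.
have zP j (e : j = i + bdeg r) : compat (z j e) by subst j.
have dz j (e : j = i + bdeg r) :
  cx_d (X r) e (tower (@repr_phi i) y (leqnn r)) = z j e r (leqnn r).
  by subst j; rewrite tower_top.
exists (NerveElt (compat_tower y) zP dz); split => //=.
exact: tower_top.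
Qed.

Lemma counit_surj r i (x : X r i) : exists q, counit r i q = x.
Proof.
have [||a [<- _]] := @nerve_elt_ex r i _ erefl x
    (fun k (h : (k <= r)%N) => tower (@repr_phi _) (cx_d (X r) erefl x) h).
- exact: compat_tower.
- by rewrite tower_top.
by exists (bar NX r a); apply: counit_bar.
Qed.

Lemma sdeg_bdegS r (i j : int * int) :
  i + bdeg r.+1 = j + bdeg r -> i = j + sdeg.
Proof.
move=> e; apply: (addIr (bdeg r.+1)); rewrite e.
by rewrite (bdegS (i := j) erefl erefl).
Qed.

(** The substantial half of the description of S_r.  When the top entry
    vanishes so do its image under d and the classes of the entries just below
    in both halves; these entries are therefore boundaries d y and d x, and
    [nerve_elt_ex] turns y and x into c and b whose primed halves are the two
    halves of [a] with the final zero removed, which s puts back. *)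
Lemma nerve_top0 r i (a : nerve_elt X r.+1 i) :
  nx a (leqnn r.+1) = 0 ->
  exists j (e : i = j + sdeg) (b : nerve_elt X r j)
         k l (e1 : l = k + sdeg) (e2 : i = l + bdeg r.+1) (c : nerve_elt X r k),
    a = lw_s NX r e b + cx_d (NX r.+1) e2 (lw_s NX r e1 c).
Proof.
move=> a0; have a'0 : nx' a erefl (leqnn r.+1) = 0 by rewrite -nx_d a0 linear0.
have := nxP a (leqnn r.+1); rewrite a0 linear0.
case/is_class0_ex=> k [ek [y dy]].
have := nx'P a (erefl (i + bdeg r.+1)) (leqnn r.+1).
rewrite a'0 linear0 => /is_class0_ex[j [ej [x dx]]].
have [|c [_ c'E]] := @nerve_elt_ex _ _ _ ek y _ (compat_restrict (nxP a)).
  by rewrite -dy; congr nx; apply: bool_irrelevance.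
have [|b [_ b'E]] := @nerve_elt_ex _ _ _ ej x _ (compat_restrict (nx'P a erefl)).
  by rewrite -dx; congr nx'; apply: bool_irrelevance.
have el : i = k + sdeg + bdeg r.+1 by rewrite (bdegS erefl erefl).
exists j, (sdeg_bdegS ej), b, k, _, erefl, el, c.
apply: nerve_eltP => [m h|m e m' h] /=.
  rewrite add0r; have [em|nem] := m =P r.+1.
    by subst m; rewrite extend0_out (bool_irrelevance h (leqnn _)).
  have h' := leq_of_leqS_neq h nem.
  rewrite (extend0_in _ _ h') (eq_irrelevance (bdegS _ _) ek) c'E.
  by congr nx; apply: bool_irrelevance.
rewrite addr0; subst m; have [em|nem] := m' =P r.+1.
  by subst m'; rewrite extend0_out (bool_irrelevance h (leqnn _)).
have h' := leq_of_leqS_neq h nem.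
rewrite (extend0_in _ _ h') (eq_irrelevance (bdegS _ _) ej) b'E.
by congr nx'; apply: bool_irrelevance.
Qed.

(** In N(X)_0 the top entry is the only one, so it determines the element; in
    higher degrees [nerve_top0] applies. *)
Lemma counit_inj r i q : counit r i q = 0 -> q = 0.
Proof.
have [a <-] := bar_surj q; rewrite counitE.
case: r q a => [|r] q a a0.
  suff -> : a = 0 by apply: bar0.
  have nx0 k (h : (k <= 0)%N) : nx a h = 0.
    by case: k h => // h; rewrite -[RHS]a0; congr nx; apply: bool_irrelevance.
  apply: nerve_eltP => [k h|j e [|k] h] //=.
  by rewrite (bool_irrelevance h (leqnn 0)) -nx_d nx0 linear0.
have [j [e [b [k [l [e1 [e2 [c ->]]]]]]]] := nerve_top0 a0.
by rewrite barD bar_s bar_ds addr0.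
Qed.

Lemma counit_is_iso : @is_iso (ESpSe R) (Q NX) X counit.
Proof. exact: bijective_is_iso counit_inj counit_surj. Qed.

(** Witness maps of a nerve drop the last entry, so iterating them exposes each
    entry as a top entry; this gives the triangle identity for the nerve. *)
Lemma nx_w_tower r i (a : nerve_elt X r i) k (h : (k <= r)%N) :
  nx (tower (fun r => lw_w NX r i) a h) (leqnn k) = nx a h.
Proof.
elim: r a k h => [|r IH] a k h.
  by case: k h => // h; rewrite tower_top; congr nx; apply: bool_irrelevance.
have [e|ne] := k =P r.+1.
  by subst k; rewrite tower_top; congr nx; apply: bool_irrelevance.
have h' := leq_of_leqS_neq h ne; rewrite (towerS _ _ h h') IH /=.
by congr nx; apply: bool_irrelevance.
Qed.

End Counit.

(** * The unit and its surjectivity *)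

Section Unit.
Variable L : lwb R.

Definition w_tower r i (a : L r i) k (h : (k <= r)%N) : L k i :=
  tower (fun r => lw_w L r i) a h.

Lemma w_tower_linear r i t (a b : L r i) k (h : (k <= r)%N) :
  w_tower (t *: a + b) h = t *: w_tower a h + w_tower b h.
Proof.
rewrite /w_tower; elim: r a b k h => [|r IH] a b k h.
  by case: k h => // h; rewrite !tower_top.
have [e|ne] := k =P r.+1; first by subst k; rewrite !tower_top.
by have h' := leq_of_leqS_neq h ne; rewrite !(towerS _ _ h h') linearP IH.
Qed.

Lemma w_tower0 r i k (h : (k <= r)%N) : w_tower (0 : L r i) h = 0.
Proof.
have := w_tower_linear (-1) (0 : L r i) 0 h.
by rewrite !scaleN1r oppr0 addr0 => ->; rewrite addNr.
Qed.

Lemma w_tower_witn j k i (a : L (j + k)%N i) (h : (k <= j + k)%N) :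
  w_tower a h = witn L j k a.
Proof.
elim: j a h => [|j IH] a h; first exact: tower_top.
by rewrite /w_tower (towerS _ _ h (leq_addl j k)); apply: IH.
Qed.

Lemma compat_bar_w_tower r i (a : L r i) :
  compat (X := Q L) (fun k h => bar L k (w_tower a h)).
Proof.
move=> k h; rewrite /w_tower (tower_step _ _ h); exact: is_class_Q_phi.
Qed.

Lemma unit_top r i (a : L r i) j (e : j = i + bdeg r) :
  cx_d (Q L r) e (bar L r (w_tower a (leqnn r)))
  = bar L r (w_tower (cx_d (L r) e a) (leqnn r)).
Proof. by rewrite /w_tower !tower_top bar_d. Qed.

Definition unit_fun r i (a : L r i) : nerve_elt (Q L) r i :=
  NerveElt (compat_bar_w_tower a)
    (fun j e => compat_bar_w_tower (cx_d (L r) e a)) (unit_top a).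

Fact unit_linear r i : linear (@unit_fun r i).
Proof.
move=> t a b; apply: nerve_eltP => [k h|j e k h] /=.
  by rewrite w_tower_linear bar_linear.
by rewrite linearP w_tower_linear bar_linear.
Qed.

Fact unit_d r i j (e : j = i + bdeg r) a :
  mklin (@unit_linear r j) (cx_d (L r) e a)
  = cx_d (nerve_cx (Q L) r) e (mklin (@unit_linear r i) a).
Proof.
apply: nerve_eltP => [//|k e' l h] /=.
by rewrite cx_dd w_tower0 bar0.
Qed.

Definition unit_cx r : cxmor (L r) (nerve_cx (Q L) r) :=
  @Cxmor R r (L r) (nerve_cx (Q L) r) (fun i => mklin (@unit_linear r i))
    (@unit_d r).

Fact unit_w r i (a : L r.+1 i) :
  unit_cx r i (lw_w L r i a) = lw_w (nerve_ob (Q L)) r i (unit_cx r.+1 i a).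
Proof.
apply: nerve_eltP => [k h|k e l h] /=.
  by rewrite /w_tower (towerS _ _ (leqW h) h).
by rewrite d_w w_tower0 bar0.
Qed.

(** Below the top, w s = 0 kills the unprimed half and w d s = d gives the
    entries of eta(a) in the primed half; the top entries vanish because s a and
    d s a are degenerate. *)
Fact unit_s r i j (e : j = i + sdeg) (a : L r i) :
  unit_cx r.+1 j (lw_s L r e a) = lw_s (nerve_ob (Q L)) r e (unit_cx r i a).
Proof.
apply: nerve_eltP => [k h|k e' l h] /=.
  have [ek|ne] := k =P r.+1; first by subst k; rewrite /w_tower tower_top bar_s.
  have h' := leq_of_leqS_neq h ne; rewrite /w_tower (towerS _ _ h h') lw_ws.
  by rewrite -/(w_tower 0 h') w_tower0 bar0.
have [el|ne] := l =P r.+1.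
  by subst l; rewrite /w_tower tower_top bar_ds extend0_out.
have h' := leq_of_leqS_neq h ne.
rewrite /w_tower (towerS _ _ h h') (extend0_in _ _ h').
by rewrite -(lw_wds (bdegS e e')).
Qed.

Definition unit : lwmor L (nerve_ob (Q L)) :=
  @Lwmor R L (nerve_ob (Q L)) unit_cx unit_w unit_s.

End Unit.

(** Lifting the top entry leaves an error with top entry 0, hence of the form
    s b1 + d s c1 by [nerve_top0]; the induction hypothesis lifts b1 and c1. *)
Lemma unit_surj (L : lwb R) r i (b : nerve_elt (Q L) r i) :
  exists a : L r i, unit L r i a = b.
Proof.
have same_top r' i' (c : nerve_elt (Q L) r' i') :
    exists a, nx c (leqnn r') = nx (unit L r' i' a) (leqnn r').
  have [a aE] := bar_surj (nx c (leqnn r')); exists a.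
  by rewrite -aE /= /w_tower tower_top.
elim: r i b => [|r IH] i b; have [a aE] := same_top _ _ b.
  exists a; apply: (@nerve_eltP R (Q L) 0 i) => [[|k] h|j e [|k] h] //.
    by rewrite (bool_irrelevance h (leqnn 0)) aE.
  by rewrite (bool_irrelevance h (leqnn 0)) -!nx_d aE.
have : nx (b - unit L r.+1 i a) (leqnn r.+1) = 0 by rewrite /= aE subrr.
case/nerve_top0=> j [e [b1 [k [l [e1 [e2 [c1 ba]]]]]]].
have [b2 b2E] := IH _ b1; have [c2 c2E] := IH _ c1.
exists (lw_s L r e b2 + cx_d (L r.+1) e2 (lw_s L r e1 c2) + a).
by rewrite !linearD cxm_d !lwm_s b2E c2E -ba subrK.
Qed.

(** * The adjunction *)

Definition Qfunctor : functor (LWB R) (ESpSe R) :=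
  @Functor (LWB R) (ESpSe R) Q Qmap Qmap_id Qmap_comp.

Lemma w_tower_map (L M : lwb R) (f : lwmor L M) r i (a : L r i) k
    (h : (k <= r)%N) :
  f k i (w_tower a h) = w_tower (f r i a) h.
Proof.
apply: (@tower_map (fun r => L r i) (fun r => M r i) _ _ (fun r => f r i)).
by move=> m x; apply: lwm_w.
Qed.

Fact Q_unit_nat (L M : LWB R) (f : mor L M) :
  @compm (LWB R) L (nerve_ob (Q L)) (nerve_ob (Q M))
    (fmap (nerve R) (fmap Qfunctor f)) (unit L)
  = @compm (LWB R) L M (nerve R (Q M)) (unit M) f.
Proof.
apply: lwmor_ext => r i a; apply: nerve_eltP => [k h|j e k h].
  by rewrite [LHS]QmapE w_tower_map.
by rewrite [LHS]QmapE w_tower_map cxm_d.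
Qed.

Fact Q_counit_nat (X Y : ESpSe R) (f : mor X Y) :
  @compm (ESpSe R) (Q (nerve_ob X)) (Q (nerve_ob Y)) Y
    (counit Y) (fmap Qfunctor (fmap (nerve R) f))
  = @compm (ESpSe R) (Q (nerve_ob X)) X Y f (counit X).
Proof.
apply: Qmor_ext => r i a.
rewrite [LHS](congr1 (counit Y r i) (QmapE _ _)) counitE.
by rewrite [RHS](congr1 (f r i) (counitE _)).
Qed.

Fact Q_triangle (L : LWB R) :
  @compm (ESpSe R) (Q L) (Q (nerve_ob (Q L))) (Q L)
    (counit (Q L)) (@fmap _ _ Qfunctor L (nerve_ob (Q L)) (unit L))
  = @idm (ESpSe R) (Q L).
Proof.
apply: Qmor_ext => r i a.
rewrite [LHS](congr1 (counit (Q L) r i) (QmapE _ _)) counitE /=.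
by rewrite /w_tower tower_top.
Qed.

Fact nerve_triangle (X : ESpSe R) :
  @compm (LWB R) (nerve_ob X) (nerve_ob (Q (nerve_ob X))) (nerve_ob X)
    (@fmap _ _ (nerve R) (Q (nerve_ob X)) X (counit X)) (unit (nerve_ob X))
  = @idm (LWB R) (nerve R X).
Proof.
apply: lwmor_ext => r i a; apply: nerve_eltP => [k h|j e k h].
  by rewrite [LHS]counitE nx_w_tower.
by rewrite [LHS]counitE nx_w_tower.
Qed.

Definition Q_nerve_adjunction : adjunction Qfunctor (nerve R) :=
  @Adjunction (LWB R) (ESpSe R) Qfunctor (nerve R) unit counit
    Q_unit_nat Q_counit_nat Q_triangle nerve_triangle.

End Reflection.

Theorem theorem5p1p3 (R : comPzRingType) :
  exists (phi : forall (L : lwb R) (r : nat) (i : int * int),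
            {linear Qcx L r.+1 i -> homology (Qcx L r) i})
         (Qmap : forall L M : LWB R,
            mor L M -> @mor (ESpSe R) (Qob phi L) (Qob phi M))
         (Qmap_id : forall L : LWB R, Qmap L L (idm L) = idm _)
         (Qmap_comp : forall (L M N : LWB R) (g : mor M N) (f : mor L M),
            Qmap L N (compm g f) = compm (Qmap M N g) (Qmap L M f)),
  let Q : functor (LWB R) (ESpSe R) :=
    @Functor (LWB R) (ESpSe R) (Qob phi) Qmap Qmap_id Qmap_comp in
  exists adj : adjunction Q (nerve R),
    (forall (L : lwb R) (r : nat) (i : int * int) (a : L r.+1 i),
       is_class (bar L r (lw_w L r i a)) (phi L r i (bar L r.+1 a)))
    /\ (forall (X : espse R) (r : nat) (i : int * int) (a : nerve_elt X r i),
         esm (adj_counit adj X) r i (bar (nerve_ob X) r a) = nx a (leqnn r))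
    /\ (forall X : ESpSe R, is_iso (adj_counit adj X))
    /\ fully_faithful (nerve R)
    /\ essentially_surjective Q
    /\ (forall (L : lwb R) (j k : nat) (i : int * int) (a : L (j + k)%N i)
           (h : (k <= j + k)%N),
         let b : nerve_elt (Qob phi L) (j + k) i :=
           lwm (adj_unit adj L) (j + k)%N i a in
         nx b h = bar L k (witn L j k a)
         /\ (forall (i' : int * int) (e : i' = (i + bdeg (j + k))%R),
              nx' b e h = bar L k (witn L j k (cx_d (L (j + k)%N) e a))))
    /\ (forall (L : lwb R) (r : nat) (i : int * int)
           (b : nerve_elt (Qob phi L) r i),
         exists a : L r i, lwm (adj_unit adj L) r i a = b).
Proof.
exists (@Q_phi R), (@Qmap R), (@Qmap_id R), (@Qmap_comp R) => Q.
exists (Q_nerve_adjunction R).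
have counit_iso (X : ESpSe R) : is_iso (adj_counit (Q_nerve_adjunction R) X).
  exact: counit_is_iso.
do 6?split.
- by move=> L r i a; apply: is_class_Q_phi.
- by move=> X r i a; apply: counitE.
- exact: counit_iso.
- exact: counit_iso_fully_faithful counit_iso.
- exact: counit_iso_essentially_surjective counit_iso.
- move=> L j k i a h b; split=> [|i' e].
    by rewrite -(w_tower_witn a h).
  by rewrite -(w_tower_witn _ h).
- by move=> L r i b; apply: unit_surj.
Qed.
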